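(* For every topological space $X$ with $nu(X)\le 2^{\omega}$, $$|X|\le 2^{\chi(X)\, wL_c(X)}.$$
   Context: $\overline{U}$ denotes the closure of $U$ in $X$, and $\mathcal{N}_x$ denotes the family of all open neighborhoods of $x$ in $X$. The exponent $\chi(X)\,wL_c(X)$ is the product of cardinals. $\chi(X)$ is the character of $X$: the smallest infinite cardinal $\chi$ such that every point of $X$ has a neighborhood base of cardinality at most $\chi$. $wL_c(X)$ is the smallest infinite cardinal $\tau$ such that whenever $A$ is a closed subset of $X$ and $\mathcal{U}$ is a family of open subsets of $X$ covering $A$, there is $\mathcal{V}\subset\mathcal{U}$ with $|\mathcal{V}|\le\tau$ and $A\subset\overline{\bigcup\mathcal{V}}$. A nonempty set $M\subset X$ is finitely non-Urysohn if for every nonempty finite $F\subset M$ and every choice of open neighborhoods $U_x\in\mathcal{N}_x$ ($x\in F$), $\bigcap_{x\in F}\overline{U_x}\ne\emptyset$. The non-Urysohn number of $X$ is the cardinal $nu(X)=1+\sup\{|M|: M \text{ is a finitely non-Urysohn subset of } X\}$; it may be finite. *)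

(* Defs.v *)
From HB Require Import structures.
From mathcomp Require Import all_boot.
From mathcomp Require Import boolp classical_sets functions cardinality.
From mathcomp Require Import topology.

Set Implicit Arguments.
Unset Strict Implicit.
Unset Printing Implicit Defensive.

Local Open Scope classical_set_scope.
Local Open Scope card_scope.

(** The cardinality library only compares cardinals, so a cardinal is
    represented by a type having that many elements: a cardinal invariant is a
    type, determined up to bijection, and kappa * lambda, kappa + 1 and
    2 ^ kappa are represented by K * L, option K and set K. *)

Definition is_least_cardinal (P : Type -> Prop) (K : Type) : Prop :=
  P K /\ forall K' : Type, P K' -> [set: K] #<= [set: K'].

Lemma least_card_family (V : Type) (F : set (set V)) : F !=set0 ->
  exists2 A, F A & forall B, F B -> A #<= B.
Proof.
move=> [A0 FA0].
have [v0 | V0] := pselect (inhabited V); last first.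
  exists A0 => // B _; apply: subset_card_le => v; case: V0; exact: inhabits.
pose good (S : set (set V -> V)) := forall A, F A ->
  (forall f, S f -> A (f A)) /\
  (forall f g, S f -> S g -> f A = g A -> f = g).
have [|S [goodS maxS]] := @Zorn_bigcup _ good.
  move=> C subC totC A FA.
  split=> [f [S CS Sf]|f g [S CS Sf] [S' CS' S'g]].
    by have [+ _] := subC _ CS _ FA; apply.
  have [SS'|S'S] := totC _ _ CS CS'.
    by have [_] := subC _ CS' _ FA; apply => //; exact: SS'.
  by have [_] := subC _ CS _ FA; apply => //; exact: S'S.
have [[A [FA surjA]]|nosurj] := pselect (exists A, F A /\ A `<=` [set f A | f in S]).
  exists A => // B FB.
  have /card_le_trans : A #<= S.
    apply: (card_le_trans (subset_card_le surjA)).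
    exact: card_image_le.
  apply; suff : [set f B | f in S] #= S.
    rewrite card_eq_sym card_eq_le => /andP[/card_le_trans + _]; apply.
    apply: subset_card_le => _ [f Sf <-].
    by have [+ _] := goodS _ FB; apply.
  apply: inj_card_eq => f g; rewrite !inE => Sf Sg.
  by have [_] := goodS _ FB; apply.
exfalso.
have /choice[h hP] : forall A, exists v, F A -> A v /\ ~ [set f A | f in S] v.
  move=> A; have [FA|] := pselect (F A); last by case: v0 => v; exists v.
  apply: contrapT => noV; apply: nosurj; exists A; split=> // v Av.
  by apply: contrapT => nv; apply: noV; exists v.
have Sh : ~ S h by move=> Sh; have [_ []] := hP _ FA0; exists h.
apply: (maxS (h |` S)).
  by split; [move=> f Sf; right | move=> /(_ h); apply: contra_not Sh; apply; left].
move=> A FA; split=> [f [->|Sf]|f g [->|Sf] [->|Sg] //].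
- by have [] := hP _ FA.
- by have [+ _] := goodS _ FA; apply.
- by move=> hg; have [_ []] := hP _ FA; exists g.
- by move=> fh; have [_ []] := hP _ FA; exists f.
- by have [_] := goodS _ FA; apply.
Qed.

Lemma card_le_total (T U : Type) :
  [set: T] #<= [set: U] \/ [set: U] #<= [set: T].
Proof.
pose A := [set (inl t : T + U) | t in [set: T]].
pose B := [set (inr u : T + U) | u in [set: U]].
have AT : A #= [set: T] by apply: inj_card_eq => s t _ _ [].
have BU : B #= [set: U] by apply: inj_card_eq => s t _ _ [].
have [|D [->|->] DP] := @least_card_family _ [set A; B]; first by exists A; left.
- left; have : A #<= B by apply: DP; right.
  by rewrite (card_le_eql AT) (card_le_eqr BU).
- right; have : B #<= A by apply: DP; left.
  by rewrite (card_le_eql BU) (card_le_eqr AT).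
Qed.

Lemma ex_least_cardinal (P : Type -> Prop) :
    (forall K L : Type, [set: K] #= [set: L] -> P K -> P L) ->
  (exists K, P K) -> exists K, is_least_cardinal P K.
Proof.
move=> Peq [K0 PK0].
have [|A PA minA] := @least_card_family K0 [set A : set K0 | P A].
  by exists setT; apply: Peq PK0; exact: card_setT_sym.
exists A; split=> // K PK; rewrite (card_le_eql (card_setT A)).
have [K0K|/card_leP[f]] := card_le_total K0 K.
  exact: card_le_trans (card_leT A) K0K.
pose g (k : K) : K0 := val (f (exist _ k (mem_set I))).
have gK : [set g k | k in [set: K]] #= [set: K].
  apply: inj_card_eq => k l _ _ /val_inj fkl.
  by have [] := inj (in_setT _) (in_setT _) fkl.
rewrite -(card_le_eqr gK); apply: minA; apply: Peq PK.
rewrite card_eq_sym; apply: card_eq_trans gK; exact: card_setT.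
Qed.

Definition least_cardinal (P : Type -> Prop)
    (exP : exists K, is_least_cardinal P K) : Type :=
  sval (cid exP).

Lemma least_cardinalP (P : Type -> Prop)
    (exP : exists K, is_least_cardinal P K) :
  is_least_cardinal P (least_cardinal exP).
Proof. exact: svalP (cid exP). Qed.

Lemma infinite_setT_card_eq (K L : Type) : [set: K] #= [set: L] ->
  infinite_set [set: K] -> infinite_set [set: L].
Proof.
move=> KL; apply: contra_not => -[n Ln]; exists n; exact: card_eq_trans KL Ln.
Qed.

Lemma infinite_setT_nat_sum (T : Type) : infinite_set [set: nat + T].
Proof.
move=> /(card_le_finite _) fin; apply: infinite_nat; apply: fin.
apply: (@card_le_trans _ _ _ [set (inl n : nat + T) | n in [set: nat]]).
  have : [set (inl n : nat + T) | n in [set: nat]] #= [set: nat].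
    by apply: inj_card_eq => m n _ _ [].
  by rewrite card_eq_sym card_eq_le => /andP[].
exact: card_leT.
Qed.

Lemma card_le_nat_sum (T : Type) (A : set T) : A #<= [set: nat + T].
Proof.
apply: (@card_le_trans _ _ _ [set (inr t : nat + T) | t in A]).
  have : [set (inr t : nat + T) | t in A] #= A.
    by apply: inj_card_eq => m n _ _ [].
  by rewrite card_eq_sym card_eq_le => /andP[].
exact: card_leT.
Qed.

Definition neighborhood_base (X : topologicalType) (x : X) (B : set (set X)) :
    Prop :=
  B `<=` nbhs x /\ forall U, nbhs x U -> exists2 V, B V & V `<=` U.

Definition character_bound (X : topologicalType) (K : Type) : Prop :=
  infinite_set [set: K] /\
  forall x : X, exists2 B, neighborhood_base x B & B #<= [set: K].

Lemma ex_character (X : topologicalType) :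
  exists K, is_least_cardinal (character_bound X) K.
Proof.
apply: ex_least_cardinal => [K L KL [infK BK]|].
  split; first exact: infinite_setT_card_eq KL infK.
  by move=> x; have [B xB ?] := BK x; exists B; rewrite // -(card_le_eqr KL).
exists (nat + set X)%type; split; first exact: infinite_setT_nat_sum.
move=> x; exists (nbhs x); last exact: card_le_nat_sum.
by split=> // U xU; exists U.
Qed.

Definition character (X : topologicalType) : Type :=
  least_cardinal (ex_character X).

Definition weak_Lindelof_closed_bound (X : topologicalType) (T : Type) : Prop :=
  infinite_set [set: T] /\
  forall (A : set X) (U : set (set X)), closed A -> U `<=` open ->
    A `<=` \bigcup_(u in U) u ->
  exists V : set (set X),
    [/\ V `<=` U, V #<= [set: T] & A `<=` closure (\bigcup_(v in V) v)].

Lemma ex_weak_Lindelof_closed (X : topologicalType) :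
  exists T, is_least_cardinal (weak_Lindelof_closed_bound X) T.
Proof.
apply: ex_least_cardinal => [K L KL [infK BK]|].
  split; first exact: infinite_setT_card_eq KL infK.
  move=> A U cA oU AU; have [V [VU VK AV]] := BK A U cA oU AU.
  by exists V; rewrite -(card_le_eqr KL).
exists (nat + set X)%type; split; first exact: infinite_setT_nat_sum.
move=> A U cA oU AU; exists U; split=> //; first exact: card_le_nat_sum.
exact: subset_trans AU (@subset_closure _ _).
Qed.

Definition weak_Lindelof_closed (X : topologicalType) : Type :=
  least_cardinal (ex_weak_Lindelof_closed X).

Definition finitely_nonUrysohn (X : topologicalType) (M : set X) : Prop :=
  M !=set0 /\
  forall F : set X, finite_set F -> F !=set0 -> F `<=` M ->
  forall U : X -> set X, (forall x, F x -> open_nbhs x (U x)) ->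
  \bigcap_(x in F) closure (U x) !=set0.

(** The supremum below is taken among all cardinals, finite ones included, and
    is 0 for the empty space, which has no finitely non-Urysohn subset. *)
Definition nonUrysohn_bound (X : topologicalType) (K : Type) : Prop :=
  forall M : set X, finitely_nonUrysohn M -> M #<= [set: K].

Lemma ex_nonUrysohn_sup (X : topologicalType) :
  exists K, is_least_cardinal (nonUrysohn_bound X) K.
Proof.
apply: ex_least_cardinal => [K L KL BK M /BK|]; first by rewrite (card_le_eqr KL).
by exists X => M _; exact: card_leT.
Qed.

Definition nonUrysohn_number (X : topologicalType) : Type :=
  option (least_cardinal (ex_nonUrysohn_sup X)).

(* Main.v *)
Require Import Defs.
From HB Require Import structures.
From mathcomp Require Import all_boot.
From mathcomp Require Import boolp classical_sets functions cardinality.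
From mathcomp Require Import topology.

Set Implicit Arguments.
Unset Strict Implicit.

Local Open Scope classical_set_scope.
Local Open Scope card_scope.

(** Write K for character X * weak_Lindelof_closed X,
    so that both invariants are bounded by the infinite cardinal K.  Number a
    base W x k (k : K) of open neighbourhoods of every point x in such a way
    that finitely many prescribed neighbourhoods of finitely many points are
    refined by basic ones with one common index (ex_directed_base).  Then for
    every family f : K -> X the points x with f k in the closure of W x k for
    all k form a finitely non-Urysohn set as soon as they exist
    (theta_limits_nonUrysohn), so by hypothesis there are at most 2 ^ nat of
    them, and each is determined by f and a set of naturals.

    Take the least set H that contains a point and is closed under two
    operations on K-indexed families: adding the points that such a family
    determines together with a set of naturals, and adding a point outside the
    closure of the union of K basic neighbourhoods of points of H, provided that
    this closure is not the whole space.  The elements of H are the values of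
    well-founded terms of arity K with at most 2 ^ K labels, and such a term is
    coded by the set of its labelled finite branches, so H has at most 2 ^ K
    elements (ex_small_closed_set).  Closure under the first operation says
    that H is theta-closed: it contains every point all of whose closed neighbourhoods meet H.
    A point q outside H would
    then have a basic neighbourhood W q k whose closure misses H, and H, which
    is closed, would be covered by basic neighbourhoods disjoint from W q k.  By
    the weak Lindelof property H lies in the closure of the union of K of these,
    which misses q, and the second operation puts into H a point outside that
    closure (closed_set_full).  Hence H = X.

    The counting rests on K * K <= K for infinite K (infinite_square), which
    comes from Zorn's lemma applied to injections D * D -> D with D a subset of
    K. *)

(** * Comparing cardinals through functions *)

(** The target type is inhabited because an injection defined on A alone has to
    be extended to all of T. *)
Lemma card_le_injP (T U : Type) (A : set T) (B : set U) (u0 : U) :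
  A #<= B <-> exists f : T -> U, (forall x, A x -> B (f x)) /\
    forall x y, A x -> A y -> f x = f y -> x = y.
Proof.
elim/Ppointed: U u0 => U u0 in B *; first by case: (no u0).
split=> [/pcard_leP[f]|[f [fAB finj]]].
  exists f; split=> [x Ax|x y Ax Ay]; first exact: funS.
  by apply: (@inj _ _ _ f); exact: mem_set.
have fi : {in A &, injective f} by move=> x y /set_mem Ax /set_mem Ay; exact: finj.
apply: (@card_le_trans _ _ _ (f @` A)).
  by rewrite (card_le_eqr (inj_card_eq fi)).
by apply: subset_card_le => _ [x Ax <-]; exact: fAB.
Qed.

Lemma injective_card_le (T U : Type) (f : T -> U) :
  injective f -> [set: T] #<= [set: U].
Proof.
elim/Ppointed: T => T in f * => finj; first exact: card_le_emptyl.
by apply/(card_le_injP _ _ (f point)); exists f; split=> // x y _ _; exact: finj.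
Qed.

Lemma card_le_injective (T U : Type) : [set: T] #<= [set: U] ->
  exists f : T -> U, injective f.
Proof.
move=> /card_leP[f]; exists (fun t => val (f (SigSub (mem_set (I : setT t))))).
by move=> s t /val_inj /(inj (in_setT _) (in_setT _)) [].
Qed.

Lemma card_le_enum (T U : Type) (A : set T) : A !=set0 -> A #<= [set: U] ->
  exists f : U -> T, (forall u, A (f u)) /\ forall x, A x -> exists u, f u = x.
Proof.
move=> [a0 Aa0] AU; have [[u0]|noU] := pselect (inhabited U); last first.
  have U0 : [set: U] = set0.
    by apply/seteqP; split=> // u; case: noU; exact: inhabits.
  by move: AU; rewrite U0 card_le0 => /eqP A0; move: Aa0; rewrite A0.
have [g [_ ginj]] := (card_le_injP A _ u0).1 AU.
have /choice[f fP] u : exists x, A x /\ forall y, A y -> g y = u -> x = y.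
  have [[x [Ax <-]]|nox] := pselect (exists x, A x /\ g x = u).
    by exists x; split=> // y Ay /esym; exact: ginj.
  by exists a0; split=> // y Ay gy; case: nox; exists y.
exists f; split=> [u|x Ax]; first by have [] := fP u.
by exists (g x); apply: (fP _).2.
Qed.

(** * The square of an infinite cardinal *)

(** An injection from D * D to D, kept as a function on all of K so that
    restriction is plain agreement on D. *)
Definition pairing_on (K : Type) (D : set K) (f : K -> K -> K) : Prop :=
  (forall x y, D x -> D y -> D (f x y)) /\
  (forall x y x' y', D x -> D y -> D x' -> D y' ->
    f x y = f x' y' -> x = x' /\ y = y').

(** Zorn's lemma for extension of pairings.  Extension is only a preorder, as two
    pairings that extend each other may differ outside their domain; the union of a
    chain is glued from its members, any two of which agree wherever both are defined. *)
Lemma ex_maximal_pairing (K : Type) (D0 : set K) (f0 : K -> K -> K) :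
  pairing_on D0 f0 ->
  exists D f, [/\ D0 `<=` D, pairing_on D f &
    forall D' f', D `<=` D' -> pairing_on D' f' ->
      (forall x y, D x -> D y -> f' x y = f x y) -> D' `<=` D].
Proof.
move=> pf0.
pose T := {p : set K * (K -> K -> K) | D0 `<=` p.1 /\ pairing_on p.1 p.2}.
pose dom (t : T) : set K := (sval t).1; pose fn (t : T) := (sval t).2.
pose R (s t : T) := `[< dom s `<=` dom t /\
  forall x y, dom s x -> dom s y -> fn t x y = fn s x y >].
have t0P : D0 `<=` (D0, f0).1 /\ pairing_on (D0, f0).1 (D0, f0).2 by split.
pose t0 : T := exist _ (D0, f0) t0P.
have [|||t maxD] := @ZL_preorder T t0 R.
- by move=> t; apply/asboolP; split.
- move=> r s t /asboolP[rs frs] /asboolP[st fst]; apply/asboolP; split.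
    exact: subset_trans st.
  by move=> x y rx ry; rewrite fst ?frs //; exact: rs.
- move=> C totC.
  have [[t1 Ct1]|noC] := pselect (C !=set0); last first.
    by exists t0 => s Cs; case: noC; exists s.
  have ub s t : C s -> C t -> exists r, [/\ C r, dom s `<=` dom r & dom t `<=` dom r].
    move=> Cs Ct; have [/asboolP[st _]|/asboolP[ts _]] := totC _ _ Cs Ct.
      by exists t; split.
    by exists s; split.
  pose D := \bigcup_(t in C) dom t.
  have common x y : D x -> D y -> exists t, [/\ C t, dom t x & dom t y].
    move=> [s Cs sx] [t Ct ty]; have [r [Cr sr tr]] := ub _ _ Cs Ct.
    by exists r; split=> //; [exact: sr | exact: tr].
  (* xy.1 is an arbitrary value for the pairs outside D * D. *)
  have /choice[f fP] xy : exists z, forall t, C t -> dom t xy.1 -> dom t xy.2 ->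
      z = fn t xy.1 xy.2.
    have [[Dx Dy]|noD] := pselect (D xy.1 /\ D xy.2); last first.
      exists xy.1 => t Ct tx ty; case: noD.
      by split; exists t.
    have [s [Cs sx sy]] := common _ _ Dx Dy.
    exists (fn s xy.1 xy.2) => t Ct tx ty.
    by have [/asboolP[_ ->]|/asboolP[_ ->]] := totC _ _ Cs Ct.
  have fE t x y : C t -> dom t x -> dom t y -> f (x, y) = fn t x y.
    by move=> Ct tx ty; apply: (fP (x, y)).
  have DP : D0 `<=` D /\ pairing_on D (fun x y => f (x, y)).
    split; first by move=> x D0x; exists t1 => //; exact: (svalP t1).1.
    split=> [x y Dx Dy|x y x' y' Dx Dy Dx' Dy'].
      have [t [Ct tx ty]] := common _ _ Dx Dy; exists t => //.
      by rewrite (fE t) //; apply: (svalP t).2.1.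
    have [s [Cs sx sy]] := common _ _ Dx Dy.
    have [t [Ct tx' ty']] := common _ _ Dx' Dy'.
    have [r [Cr sr tr]] := ub _ _ Cs Ct.
    rewrite !(fE r) //; do ?[exact: sr | exact: tr].
    by apply: (svalP r).2.2; do ?[exact: sr | exact: tr].
  exists (exist _ (D, fun x y => f (x, y)) DP : T) => s Cs; apply/asboolP; split.
    by move=> x sx; exists s.
  by move=> x y sx sy; exact: fE.
case: t maxD => -[D f] [/= D0D pf] maxD; exists D, f; split=> // D' f' DD' pf' ff'.
have D'P : D0 `<=` (D', f').1 /\ pairing_on (D', f').1 (D', f').2.
  by split=> //; exact: subset_trans DD'.
pose t' : T := exist _ (D', f') D'P.
have /maxD /asboolP[] // : R (exist _ (D, f) (conj D0D pf)) t'.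
exact/asboolP.
Qed.

(** A pairing on D extends to D together with a disjoint copy g @` D: every new
    pair (x, y) is sent to g of a code, in D, of the two elements of D below x
    and y and of two tags c0 or c1 telling which of x and y belong to D.  The new
    values lie in the copy, hence differ from the old ones. *)
Lemma pairing_extend (K : Type) (D : set K) (f : K -> K -> K) (g : K -> K) (c0 c1 : K) :
  pairing_on D f -> D c0 -> D c1 -> c0 <> c1 ->
  (forall x, D x -> ~ D (g x)) ->
  (forall x y, D x -> D y -> g x = g y -> x = y) ->
  exists f', pairing_on (D `|` (g @` D)) f' /\
    forall x y, D x -> D y -> f' x y = f x y.
Proof.
move=> [fD finj] Dc0 Dc1 c01 gD ginj; set D' := D `|` _.
have /choice[r rP] x : exists y, D' x -> D y /\ (D x /\ y = x \/ ~ D x /\ g y = x).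
  have [D'x|] := pselect (D' x); last by exists x.
  have [Dx|nDx] := pselect (D x); first by exists x; split=> //; left.
  by case: D'x => // -[y Dy yx]; exists y => _; split=> //; right.
pose e x := if pselect (D x) then c0 else c1.
have De x : D (e x) by rewrite /e; case: pselect.
have reP x y : D' x -> D' y -> e x = e y -> r x = r y -> x = y.
  move=> /rP[_ xP] /rP[_ yP] + rxy; rewrite /e.
  case: xP => [[Dx rx]|[nDx gx]]; case: yP => [[Dy ry]|[nDy gy]].
  - by rewrite -rx -ry.
  - by do 2![case: pselect => //= ?].
  - by do 2![case: pselect => //= ?] => /esym.
  - by rewrite -gx -gy rxy.
have Dr x : D' x -> D (r x) by move=> /rP[].
pose h x y := f (f (e x) (e y)) (f (r x) (r y)).
have Dh x y : D' x -> D' y -> D (h x y).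
  by move=> D'x D'y; apply: (fD); apply: (fD); do ?[exact: De | exact: Dr].
have hinj x y x' y' : D' x -> D' y -> D' x' -> D' y' ->
    h x y = h x' y' -> x = x' /\ y = y'.
  move=> D'x D'y D'x' D'y' hh.
  have Df a b : D' a -> D' b -> D (f (r a) (r b)) by move=> ? ?; apply: fD; exact: Dr.
  have Dfe a b : D (f (e a) (e b)) by exact: fD.
  have [ee rr] : f (e x) (e y) = f (e x') (e y') /\ f (r x) (r y) = f (r x') (r y').
    by apply: finj => //; exact: Df.
  have [||||e1 e2] := finj _ _ _ _ _ _ _ _ ee; [exact: De..|].
  have [||||r1 r2] := finj _ _ _ _ _ _ _ _ rr; [exact: Dr..|].
  by split; exact: reP.
exists (fun x y => if pselect (D x /\ D y) then f x y else g (h x y)).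
split; last by move=> x y Dx Dy; case: pselect => // -[].
split=> [x y D'x D'y|x y x' y' D'x D'y D'x' D'y'].
  case: pselect => /= [[Dx Dy]|_]; first by left; exact: fD.
  by right; exists (h x y) => //; exact: Dh.
case: pselect => /= [[Dx Dy]|n]; case: pselect => /= [[Dx' Dy']|n'].
- exact: finj.
- by move=> fg; case: (gD (h x' y')); [exact: Dh|rewrite -fg; exact: fD].
- by move=> gf; case: (gD (h x y)); [exact: Dh|rewrite gf; exact: fD].
- by move=> /ginj gh; apply: hinj => //; apply: gh; exact: Dh.
Qed.

(** A pairing of nat, transported to K, extends to a maximal pairing f on some D.
    The complement of D contains no copy of D, since f would extend to it; by
    comparability it embeds into D.  So K embeds into D + D, hence into D by f
    with two distinct tags, and f finally pairs K. *)
Lemma infinite_square (K : Type) : infinite_set [set: K] ->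
  [set: K * K] #<= [set: K].
Proof.
move=> infK; have [k0 _] := infinite_setN0 infK.
have [i iinj] := card_le_injective ((infiniteP _).1 infK).
have [i' iK] : exists i', cancel i i'.
  have /choice[i' i'P] k : exists n, forall m, i m = k -> n = m.
    have [[n <-]|non] := pselect (exists n, i n = k).
      by exists n => m /esym; exact: iinj.
    by exists 0%N => m ik; case: non; exists m.
  by exists i' => n; exact: i'P.
pose f0 (x y : K) := i (pickle (i' x, i' y)).
have pf0 : pairing_on (range i) f0.
  split=> [x y _ _|_ _ _ _ [m _ <-] [n _ <-] [m' _ <-] [n' _ <-]].
    by exists (pickle (i' x, i' y)).
  rewrite /f0 !iK => /iinj /(pcan_inj (@pickleK _)).
  by case=> -> ->.
have [D [f [i_D pf maxD]]] := ex_maximal_pairing pf0.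
have D0 : D (i 0%N) by apply: i_D; exists 0%N.
have D1 : D (i 1%N) by apply: i_D; exists 1%N.
have i01 : i 0%N <> i 1%N by move=> /iinj.
have card_sub (A B : set K) : [set: A] #<= [set: B] -> A #<= B.
  by rewrite (card_le_eql (card_setT A)) (card_le_eqr (card_setT B)).
have [/card_sub DC|/card_sub CD] := card_le_total D (~` D).
  exfalso.
  have [g [gD ginj]] := (card_le_injP _ _ k0).1 DC.
  have [f' [pf' f'f]] := pairing_extend pf D0 D1 i01 gD ginj.
  apply: (gD _ D0); apply: (maxD _ _ _ pf' f'f); first exact: subsetUl.
  by right; exists (i 0%N).
have [h [hD hinj]] := (card_le_injP _ _ k0).1 CD.
(* u embeds K into D; the tags i 0 and i 1 separate D from its complement. *)
pose u x := if pselect (D x) then f (i 0%N) x else f (i 1%N) (h x).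
have [fD finj] := pf.
have Du x : D (u x).
  by rewrite /u; case: pselect => Dx; apply: fD => //; exact: hD.
have uinj : injective u.
  move=> x y; rewrite /u; case: pselect => Dx; case: pselect => Dy.
  - by move=> /finj[].
  - by move=> /finj[] //; exact: hD.
  - by move=> /finj[] //; [exact: hD | move=> /esym].
  - by move=> /finj[] //; [exact: hD | exact: hD | move=> _; exact: hinj].
apply: (@injective_card_le _ _ (fun p => f (u p.1) (u p.2))) => -[x y] [x' y'] /=.
by move=> /finj[] // /uinj -> /uinj ->.
Qed.

(** A list is determined by its length and the iterated pairing of its items. *)
Lemma infinite_seq (K : Type) : infinite_set [set: K] ->
  [set: seq K] #<= [set: K].
Proof.
move=> infK; have [k0 _] := infinite_setN0 infK.
have KK := infinite_square infK.
have [p pinj] := card_le_injective KK.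
have [i iinj] := card_le_injective ((infiniteP _).1 infK).
pose c := foldr (fun x y => p (x, y)) k0.
have cinj (s t : seq K) : size s = size t -> c s = c t -> s = t.
  elim: s t => [|x s IH] [|y t] //= [/IH st] /pinj[-> /st ->] //.
apply: card_le_trans KK.
apply: (@injective_card_le _ _ (fun s => (i (size s), c s))) => s t [/iinj].
exact: cinj.
Qed.

Lemma infinite_option (K : Type) : infinite_set [set: K] ->
  [set: option K] #<= [set: K].
Proof.
move=> infK; apply: card_le_trans (infinite_seq infK).
by apply: (@injective_card_le _ _ (fun o : option K => seq_of_opt o)) => -[x|] [y|] //= [->].
Qed.

(** * Cardinals below a power of an infinite cardinal *)

Lemma powerset_card_le (T U : Type) : [set: T] #<= [set: U] ->
  [set: set T] #<= [set: set U].
Proof.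
move=> /card_le_injective[f finj].
apply: (@injective_card_le _ _ (fun A => f @` A)) => A B AB.
suff sub (C D : set T) : f @` C = f @` D -> C `<=` D.
  by apply/seteqP; split; exact: sub.
move=> CD x Cx; have : (f @` D) (f x) by rewrite -CD; exists x.
by move=> [y Dy /finj <-].
Qed.

(** A subset of option K codes an element of the sum: whether it contains None
    tells the side. *)
Lemma powerset_sum_card_le (K A B : Type) : infinite_set [set: K] ->
  [set: A] #<= [set: set K] -> [set: B] #<= [set: set K] ->
  [set: A + B] #<= [set: set K].
Proof.
move=> infK /card_le_injective[f finj] /card_le_injective[g ginj].
apply: card_le_trans (powerset_card_le (infinite_option infK)).
pose c (s : A + B) : set (option K) := match s with
  | inl a => [set o | if o is Some k then f a k else False]
  | inr b => [set o | if o is Some k then g b k else True] end.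
apply: (@injective_card_le _ _ c) => -[a|b] [a'|b'] cc.
- by congr inl; apply: finj; apply/funext => k; exact: (congr1 (@^~ (Some k)) cc).
- by exfalso; have /= -> := congr1 (@^~ None) cc.
- by exfalso; have /= <- := congr1 (@^~ None) cc.
- by congr inr; apply: ginj; apply/funext => k; exact: (congr1 (@^~ (Some k)) cc).
Qed.

(** A function is determined by its graph, a subset of K * K. *)
Lemma function_card_le (K : Type) : infinite_set [set: K] ->
  [set: K -> K] #<= [set: set K].
Proof.
move=> infK; apply: card_le_trans (powerset_card_le (infinite_square infK)).
apply: (@injective_card_le _ _ (fun h => [set p : K * K | h p.1 = p.2])) => g h gh.
by apply/funext => k; have /= := congr1 (@^~ (k, g k)) gh; rewrite propeqE => -[->].
Qed.

(** * Small sets closed under operations of infinite arity *)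

(** Formal expressions over one constant and one K-ary operation for each label;
    their values are the least set that contains the constant and is closed
    under the operations. *)
Inductive op_term (L K : Type) : Type :=
  | Leaf
  | Node of L & (K -> op_term L K).

Arguments Leaf {L K}.

Fixpoint op_value (X L K : Type) (x0 : X) (op : L -> (K -> X) -> X)
    (t : op_term L K) : X :=
  if t is Node l f then op l (fun k => op_value x0 op (f k)) else x0.

(** Unary data suffice to recover a term: at the node reached by the path p, the
    presence of (p, None) says that the node is not a leaf, and the k such that
    (p, Some k) is present form the set c l that represents its label l. *)
Fixpoint op_term_code (L K : Type) (c : L -> set K) (t : op_term L K) :
    set (seq K * option K) :=
  fun po => match t, po with
  | Leaf, _ => False
  | Node l _, ([::], None) => True
  | Node l _, ([::], Some k) => c l k
  | Node _ f, (k :: p, o) => op_term_code c (f k) (p, o)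
  end.

Lemma op_term_code_inj (L K : Type) (c : L -> set K) :
  injective c -> injective (op_term_code c).
Proof.
move=> cinj; elim=> [|l f IH] [|l' f'] //= ff'.
- by exfalso; have /= -> := congr1 (@^~ ([::], None)) ff'.
- by exfalso; have /= <- := congr1 (@^~ ([::], None)) ff'.
have -> : l = l'.
  by apply: cinj; apply/funext => k; exact: (congr1 (@^~ ([::], Some k)) ff').
congr Node; apply/funext => k; apply: IH; apply/funext => -[p o].
exact: (congr1 (@^~ (k :: p, o)) ff').
Qed.

(** H consists of the values of the terms, whose codes are subsets of the set
    seq K * option K, which is no larger than K. *)
Lemma ex_small_closed_set (X L K : Type) (x0 : X) (op : L -> (K -> X) -> X) :
  infinite_set [set: K] -> [set: L] #<= [set: set K] ->
  exists H : set X, [/\ H x0,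
    forall l f, (forall k, H (f k)) -> H (op l f) &
    H #<= [set: set K]].
Proof.
move=> infK /card_le_injective[c cinj].
pose v := op_value x0 op; exists (range v); split; first by exists Leaf.
  move=> l f Hf; have /choice[t tP] k : exists t, v t = f k.
    by have [t _ <-] := Hf k; exists t.
  by exists (Node l t) => //=; congr op; apply/funext.
apply: (card_le_trans (card_image_le _ _)).
apply: (card_le_trans (injective_card_le (op_term_code_inj cinj))).
apply: powerset_card_le.
apply: card_le_trans (infinite_square infK).
have [s sinj] := card_le_injective (infinite_seq infK).
have [o oinj] := card_le_injective (infinite_option infK).
apply: (@injective_card_le _ _ (fun p => (s p.1, o p.2))) => -[a b] [a' b'] /=.
by move=> [/sinj -> /oinj ->].
Qed.

(** * Bases indexed uniformly over the space *)

(** The index k depends on F and U but not on the point: this is what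
    lets one family of points, indexed like the base, approach many points at
    once. *)
Definition directed_base (X : topologicalType) (K : Type) (W : X -> K -> set X) :
    Prop :=
  (forall x k, open_nbhs x (W x k)) /\
  forall (F : set X) (U : X -> set X), finite_set F ->
    (forall x, F x -> nbhs x (U x)) ->
    exists k, forall x, F x -> W x k `<=` U x.

Lemma directed_base_nbhs (X : topologicalType) (K : Type) (W : X -> K -> set X) :
  directed_base W -> forall x U, nbhs x U -> exists k, W x k `<=` U.
Proof.
move=> [_ dirW] x U xU.
have [|k kP] := dirW [set x] (fun=> U) (finite_set1 _); first by move=> _ ->.
by exists k; exact: kP.
Qed.

(** Enumerate a base at each point by K and index the new base by the finite
    lists over K, intersecting the neighbourhoods whose indices are listed: a
    list that collects one suitable index for each point of F serves all of F.
    K has no more finite lists than elements. *)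
Lemma ex_directed_base (X : topologicalType) (K : Type) :
  character_bound X K -> exists W : X -> K -> set X, directed_base W.
Proof.
move=> [infK baseK].
have /choice[V VP] (x : X) : exists V : K -> set X,
    (forall a, nbhs x (V a)) /\ forall U, nbhs x U -> exists a, V a `<=` U.
  have [B [Bx xB] /card_le_enum] := baseK x.
  case; first by have [V BV _] := xB _ filterT; exists V.
  move=> V [BV VB]; exists V; split=> [a|U /xB[A /VB[a <-] AU]]; first exact/Bx.
  by exists a.
have [||d [_ d_surj]] := @card_le_enum (seq K) K setT _ _.
- by exists [::].
- exact: infinite_seq.
have Vo x a : open_nbhs x (interior (V x a)).
  by split; [exact: open_interior | exact: (VP x).1].
exists (fun x k => \big[setI/setT]_(a <- d k) interior (V x a)); split=> [x k|F U].
  elim/big_ind: _ => // [|A B [oA Ax] [oB Bx]]; first by split; [exact: openT|].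
  by split; [exact: openI|].
move=> /finite_seqP[s ->] FU.
have /choice[a aP] (x : X) : exists a, x \in s -> V x a `<=` U x.
  have [xs|] := boolP (x \in s); last by have [a _] := (VP x).2 _ filterT; exists a.
  by have [a aU] := (VP x).2 _ (FU _ xs); exists a.
have [k dk] := d_surj (map a s) I; exists k => x xs z Wz.
move: Wz; rewrite dk big_map -bigcap_seq => /(_ x xs) /interior_subset.
exact: aP.
Qed.

(** * Points determined by a family *)

Definition theta_limits (X : topologicalType) (K : Type) (W : X -> K -> set X)
    (f : K -> X) : set X :=
  [set x | forall k, closure (W x k) (f k)].

(** Given finitely many of these points with neighbourhoods U x, a common index k
    with W x k inside U x makes f k a common point of the closures. *)
Lemma theta_limits_nonUrysohn (X : topologicalType) (K : Type)
    (W : X -> K -> set X) (f : K -> X) :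
  directed_base W -> theta_limits W f !=set0 ->
  finitely_nonUrysohn (theta_limits W f).
Proof.
move=> [_ dirW] M0; split=> // F finF _ FM U FU.
have [k Wk] := dirW _ _ finF (fun x Fx => open_nbhs_nbhs (FU x Fx)).
exists (f k) => x Fx; apply: closureS (Wk x Fx) _ _.
exact: FM.
Qed.

(** * A closed-off set is the whole space *)

(** If q is outside H, the first closure condition separates H from q by basic
    neighbourhoods, weak Lindelofness reduces them to K many, and the second
    condition yields a point of H outside the closure of their union. *)
Lemma closed_set_full (X : topologicalType) (K : Type) (W : X -> K -> set X)
    (H : set X) :
  directed_base W -> weak_Lindelof_closed_bound X K -> H !=set0 ->
  (forall f : K -> X, (forall k, H (f k)) -> theta_limits W f `<=` H) ->
  (forall (f : K -> X) (h : K -> K), (forall k, H (f k)) ->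
    ~` closure (\bigcup_k W (f k) (h k)) !=set0 ->
    ~` closure (\bigcup_k W (f k) (h k)) `&` H !=set0) ->
  H = setT.
Proof.
move=> dirW [_ wL] [p0 Hp0] Htheta Hout.
have Wbase := directed_base_nbhs dirW; have [Wopen _] := dirW.
apply/seteqP; split=> // q _; apply: contrapT => nHq.
have thetaH x : (forall k, H `&` closure (W x k) !=set0) -> H x.
  by move=> /choice[f fP]; apply: (Htheta f) => k; have [] := fP k.
have [k0 k0P] : exists k, H `&` closure (W q k) = set0.
  apply: contrapT => nok; apply/nHq/thetaH => k; apply/set0P/eqP => H0.
  by apply: nok; exists k.
have cH : closed H.
  move=> y Hy; apply: thetaH => k.
  have [x [Hx Wx]] := Hy _ (open_nbhs_nbhs (Wopen y k)).
  by exists x; split=> //; exact: subset_closure.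
(* The basic neighbourhoods of points of H that witness, being disjoint from
   W q k0, that the closure of W q k0 misses H. *)
pose U := [set u | exists p i, [/\ H p, W p i `&` W q k0 = set0 & u = W p i]].
have oU : U `<=` open by move=> _ [p [i [_ _ ->]]]; have [] := Wopen p i.
have HU : H `<=` \bigcup_(u in U) u.
  move=> p Hp; have ncp : ~ closure (W q k0) p.
    by move=> cp; have : (H `&` closure (W q k0)) p by []; rewrite k0P.
  have [B [pB BW]] : exists B, nbhs p B /\ W q k0 `&` B = set0.
    apply: contrapT => noB; apply: ncp => B pB; apply/set0P/eqP => W0.
    by apply: noB; exists B.
  have [i iB] := Wbase _ _ pB; exists (W p i); last by have [] := Wopen p i.
  exists p, i; split=> //; apply/seteqP; split=> // z [/iB Bz Wz].
  by rewrite -BW.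
have [V [VU VK HV]] := wL H U cH oU HU.
(* As p0 belongs to H, V is nonempty, hence enumerated by K. *)
have V0 : V !=set0.
  have [z [[v Vv _] _]] := HV _ Hp0 _ filterT; by exists v.
have [v [Vv vV]] := card_le_enum V0 VK.
have /choice[f fP] k : exists p, exists i,
    [/\ H p, W p i `&` W q k0 = set0 & v k = W p i] by exact/VU/Vv.
have /choice[h fhP] := fP.
have Vfh : \bigcup_(v in V) v = \bigcup_k W (f k) (h k).
  apply/seteqP; split=> z [].
    by move=> _ /vV[k <-]; have [_ _ ->] := fhP k => Wz; exists k.
  by move=> k _ Wz; exists (v k) => //; have [_ _ ->] := fhP k.
have [||z [ncz Hz]] := Hout f h.
- by move=> k; have [] := fhP k.
- exists q => /(_ _ (open_nbhs_nbhs (Wopen q k0)))[z [[k _ Wz] Wqz]].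
  by have [_ W0 _] := fhP k; have : (W (f k) (h k) `&` W q k0) z by []; rewrite W0.
- by apply: ncz; rewrite -Vfh; exact: HV.
Qed.

(** * The cardinality bound *)

(** H arises from x0 by the two operations that the previous lemma requires; a
    single choice function op performs both, taking any value when the
    requested point does not exist. *)
Lemma card_le_powerset (X : topologicalType) (K : Type) :
  character_bound X K -> weak_Lindelof_closed_bound X K ->
  nonUrysohn_bound X (set nat) ->
  [set: X] #<= [set: set K].
Proof.
move=> chiK wLK nuX; have [infK _] := chiK.
have [[x0]|noX] := pselect (inhabited X); last first.
  by apply: (@injective_card_le _ _ (fun=> set0)) => x; case: noX; exact: inhabits.
have [W dirW] := ex_directed_base chiK.
(* j f numbers the points determined by f by sets of naturals. *)
have /choice[j jP] f : exists j : X -> set nat,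
    forall x y, theta_limits W f x -> theta_limits W f y -> j x = j y -> x = y.
  have [M0|noM] := pselect (theta_limits W f !=set0); last first.
    by exists (fun=> set0) => x y Mx; case: noM; exists x.
  have /nuX/(card_le_injP _ _ set0)[j [_ ?]] := theta_limits_nonUrysohn dirW M0.
  by exists j.
(* A label n : set nat asks for the point of number n determined by f; a label
   h : K -> K asks for a point outside the closure of a union of basic
   neighbourhoods of the members of f. *)
pose good (l : set nat + (K -> K)) (f : K -> X) : set X := match l with
  | inl n => [set x | theta_limits W f x /\ j f x = n]
  | inr h => ~` closure (\bigcup_k W (f k) (h k)) end.
have /choice[op opP] lf : exists x, good lf.1 lf.2 !=set0 -> good lf.1 lf.2 x.
  have [[x gx]|nog] := pselect (good lf.1 lf.2 !=set0); last by exists x0.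
  by exists x.
have LK : [set: set nat + (K -> K)] #<= [set: set K].
  apply: powerset_sum_card_le => //; last exact: function_card_le.
  exact/powerset_card_le/infiniteP.
have [H [Hx0 Hop HK]] := ex_small_closed_set x0 (fun l f => op (l, f)) infK LK.
suff <- : H = setT by [].
apply: (closed_set_full dirW wLK); first by exists x0.
  move=> f Hf x Mx.
  have [|Mx' jx'] := opP (inl (j f x), f); first by exists x.
  by rewrite -(jP f _ _ Mx' Mx jx'); exact: (Hop _ _ Hf).
move=> f h Hf fh0; exists (op (inr h, f)); split; last exact: (Hop _ _ Hf).
exact: (opP (inr h, f)).
Qed.

Lemma character_boundW (X : topologicalType) (K L : Type) :
  [set: K] #<= [set: L] -> character_bound X K -> character_bound X L.
Proof.
move=> KL [infK BK]; split; first by move=> /(card_le_finite KL).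
by move=> x; have [B xB BleK] := BK x; exists B => //; exact: card_le_trans KL.
Qed.

Lemma weak_Lindelof_closed_boundW (X : topologicalType) (K L : Type) :
  [set: K] #<= [set: L] ->
  weak_Lindelof_closed_bound X K -> weak_Lindelof_closed_bound X L.
Proof.
move=> KL [infK wLK]; split; first by move=> /(card_le_finite KL).
move=> A U cA oU AU; have [V [VU VK AV]] := wLK A U cA oU AU.
by exists V; split=> //; exact: card_le_trans KL.
Qed.

Unset Implicit Arguments.

Theorem mainTheorem4 (X : topologicalType) :
  [set: nonUrysohn_number X] #<= [set: set nat] ->
  [set: X] #<= [set: set (character X * weak_Lindelof_closed X)].
Proof.
move=> nuX.
have [chiP _] := least_cardinalP (ex_character X).
have [wLP _] := least_cardinalP (ex_weak_Lindelof_closed X).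
have [nuP _] := least_cardinalP (ex_nonUrysohn_sup X).
have [a0 _] := infinite_setN0 chiP.1; have [b0 _] := infinite_setN0 wLP.1.
apply: card_le_powerset.
- apply: character_boundW chiP.
  by apply: (@injective_card_le _ _ (fun a => (a, b0))) => a a' [].
- apply: weak_Lindelof_closed_boundW wLP.
  by apply: (@injective_card_le _ _ (fun b => (a0, b))) => b b' [].
- move=> M /nuP MK; apply: (card_le_trans MK); apply: card_le_trans nuX.
  by apply: (@injective_card_le _ _ Some) => a a' [].
Qed.
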